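(* Let $\mathring X$ be generated by a generalized PLSEM with DAG $D^0$, intercepts $\mathring\mu_j$, edge functions $\mathring f_{j,i}$ and noise variances $\mathring\sigma_j^2$. Let $\mathbb{P}$ be the distribution of the solution $X$ of $X_j=\mathring\mu_j+\sum_{i\in\mathrm{pa}_{D^0}(j)}\mathring f_{j,i}(X_i)+\varepsilon_j$ with $\varepsilon_j\sim\mathcal{N}(0,\mathring\sigma_j^2)$ mutually independent (after recentring the functions and adjusting the intercepts this is a PLSEM). Then for every $D\in\mathscr{D}(\mathbb{P})$, $$\sum_{j=1}^p\log\mathring\sigma_j^{D}\le\sum_{j=1}^p\log\mathring\sigma_j^{D^0}.$$
   Context: A generalized PLSEM with DAG $D$ on $\{1,\dots,p\}$ is a system $\mathring X_j=\mathring\mu_j+\sum_{i\in\mathrm{pa}_D(j)}\mathring f_{j,i}(\mathring X_i)+\mathring\varepsilon_j$ with $\mathring\mu_j\in\mathbb{R}$, $\mathring f_{j,i}\in C^2(\mathbb{R})$, $\mathring f_{j,i}\not\equiv0$, $\mathbb{E}[\mathring f_{j,i}(\mathring X_i)]=0$, and $\mathring\varepsilon_1,\dots,\mathring\varepsilon_p$ jointly independent, centered, with variance $\mathring\sigma_j^2>0$ and positive density on $\mathbb{R}$. A PLSEM is a generalized PLSEM whose noise variables are Gaussian. $\mathscr{D}(\mathbb{P})=\{D:\ \mathbb{P}\text{ faithful to }D\text{ and some PLSEM with DAG }D\text{ generates }\mathbb{P}\}$, where faithfulness means the conditional independences in $\mathbb{P}$ are exactly those implied by d-separation in $D$. For a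 DAG $D$, the projected residual variance is $(\mathring\sigma_j^D)^2=\inf\mathbb{E}\big[(\mathring X_j-c-\sum_{i\in\mathrm{pa}_D(j)}g_{j,i}(\mathring X_i))^2\big]$, the infimum over $c\in\mathbb{R}$ and $g_{j,i}\in C^2(\mathbb{R})$. *)

(* Defs.v *)
From HB Require Import structures.
From mathcomp Require Import all_boot all_order all_algebra.
From mathcomp Require Import all_classical all_reals all_analysis.
From mathcomp Require Import normal_distribution.

Set Implicit Arguments.
Unset Strict Implicit.
Unset Printing Implicit Defensive.

Import Order.TTheory GRing.Theory Num.Theory.
Import numFieldNormedType.Exports.

Local Open Scope classical_set_scope.
Local Open Scope ring_scope.

Section Graphs.
Variable p : nat.
Implicit Types (D : rel 'I_p) (A B S : {set 'I_p}).

Definition is_dag D : Prop := forall i j : 'I_p, D i j -> ~~ connect D j i.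

Definition pa D (j : 'I_p) : {set 'I_p} := [set i | D i j].

Definition adjacent D (u v : 'I_p) : bool := D u v || D v u.

(* The path a :: s (a sequence of distinct, consecutively adjacent nodes) is
   blocked by S: some interior node v (with neighbours u, w on the path) is
   either a non-collider lying in S, or a collider (u -> v <- w) none of whose
   descendants (v included) lies in S. *)
Definition blocked D S (a : 'I_p) (s : seq 'I_p) : Prop :=
  let t := a :: s in
  exists m : nat, (0 < m)%N /\ (m < size s)%N /\
    let u := nth a t m.-1 in let v := nth a t m in let w := nth a t m.+1 in
    let collider := D u v && D w v in
    ((~~ collider) && (v \in S)) \/
    (collider /\ forall z : 'I_p, connect D v z -> z \notin S).

Definition dsep D A B S : Prop :=
  forall (a b : 'I_p) (s : seq 'I_p),
    a \in A -> b \in B -> path (adjacent D) a s -> uniq (a :: s) ->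
    last a s = b -> blocked D S a s.

End Graphs.

Section Prob.
Context {R : realType} {d : measure_display} {T : measurableType d}.
Variable P : probability T R.
Variable p : nat.

Definition sigmaX (X : 'I_p -> T -> R) (A : {set 'I_p}) : set (set T) :=
  smallest (sigma_algebra setT)
    [set U | exists i, i \in A /\ exists V : set R, measurable V /\ U = X i @^-1` V].

Definition cond_exp_version (G : set (set T)) (Y Z : T -> R) : Prop :=
  (forall V : set R, measurable V -> G (Z @^-1` V)) /\
  P.-integrable setT (EFin \o Z) /\
  forall F, G F -> (\int[P]_(w in F) (Y w)%:E = \int[P]_(w in F) (Z w)%:E)%E.

Definition cond_indep (X : 'I_p -> T -> R) (A B S : {set 'I_p}) : Prop :=
  forall a b : set T, sigmaX X A a -> sigmaX X B b ->
    exists Za Zb Zab : T -> R,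
      cond_exp_version (sigmaX X S) (\1_a) Za /\
      cond_exp_version (sigmaX X S) (\1_b) Zb /\
      cond_exp_version (sigmaX X S) (\1_(a `&` b)) Zab /\
      {ae P, forall w, Zab w = Za w * Zb w}.

Definition faithful (X : 'I_p -> T -> R) (D : rel 'I_p) : Prop :=
  forall A B S : {set 'I_p},
    (forall i, i \in A -> i \notin B) -> (forall i, i \in A -> i \notin S) ->
    (forall i, i \in B -> i \notin S) ->
    (cond_indep X A B S <-> dsep D A B S).

Definition mutually_indep (eps : 'I_p -> T -> R) : Prop :=
  forall V : 'I_p -> set R, (forall i, measurable (V i)) ->
    P (\bigcap_i (eps i @^-1` V i)) = (\prod_(i < p) P (eps i @^-1` V i))%E.

Definition pos_density (e : T -> R) : Prop :=
  exists g : R -> R, measurable_fun setT g /\ (forall x, 0 < g x) /\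
    forall V : set R, measurable V ->
      P (e @^-1` V) = (\int[lebesgue_measure]_(x in V) (g x)%:E)%E.

Definition gaussian (e : T -> R) (s : R) : Prop :=
  forall V : set R, measurable V -> P (e @^-1` V) = normal_prob 0 s V.

Definition C2 (f : R -> R) : Prop :=
  (forall x, derivable f x 1) /\ (forall x, derivable (derive1 f) x 1) /\
  continuous (derive1 (derive1 f)).

(* generalized PLSEM with DAG D, intercepts mu, edge functions f (f j i is
   the function on the edge i -> j), noise eps and noise std. deviations sigma *)
Definition gen_PLSEM (D : rel 'I_p) (X : 'I_p -> T -> R) (mu : 'I_p -> R)
    (f : 'I_p -> 'I_p -> R -> R) (eps : 'I_p -> T -> R) (sigma : 'I_p -> R) :
    Prop :=
  is_dag D /\
  (forall j, measurable_fun setT (X j)) /\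
  (forall j, measurable_fun setT (eps j)) /\
  (forall j i, i \in pa D j ->
     C2 (f j i) /\ f j i <> cst 0 /\
     P.-integrable setT (EFin \o (f j i \o X i)) /\
     ('E_P[f j i \o X i] = 0)%E) /\
  mutually_indep eps /\
  (forall j, ('E_P[eps j] = 0)%E /\ eps j \in Lfun P 2%:E /\ 0 < sigma j /\
             ('V_P[eps j] = (sigma j ^+ 2)%:E)%E /\ pos_density (eps j)) /\
  (forall j w, X j w = mu j + \sum_(i in pa D j) f j i (X i w) + eps j w).

Definition PLSEM (D : rel 'I_p) (X : 'I_p -> T -> R) (mu : 'I_p -> R)
    (f : 'I_p -> 'I_p -> R -> R) (eps : 'I_p -> T -> R) (sigma : 'I_p -> R) :
    Prop :=
  gen_PLSEM D X mu f eps sigma /\ forall j, gaussian (eps j) (sigma j).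

Definition proj_resvar (X : 'I_p -> T -> R) (D : rel 'I_p) (j : 'I_p) : \bar R :=
  ereal_inf [set e | exists (c : R) (g : 'I_p -> R -> R),
    (forall i, i \in pa D j -> C2 (g i)) /\
    (e = 'E_P[fun w => ((X j w - c - \sum_(i in pa D j) g i (X i w)) ^+ 2)%R])%E].

End Prob.

(* equality in law of two random vectors (on the generating pi-system of
   measurable rectangles) *)
Definition same_law {R : realType} {d d' : measure_display}
    {T : measurableType d} {T' : measurableType d'} (p : nat)
    (P : probability T R) (X : 'I_p -> T -> R)
    (Q : probability T' R) (Y : 'I_p -> T' -> R) : Prop :=
  forall V : 'I_p -> set R, (forall i, measurable (V i)) ->
    P (\bigcap_i (X i @^-1` V i)) = Q (\bigcap_i (Y i @^-1` V i)).

Definition in_scrD {R : realType} {d : measure_display} {T : measurableType d}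
    (p : nat) (P : probability T R) (X : 'I_p -> T -> R) (D : rel 'I_p) : Prop :=
  faithful P X D /\
  exists (d' : measure_display) (T' : measurableType d') (Q : probability T' R)
         (Y : 'I_p -> T' -> R) (mu : 'I_p -> R) (f : 'I_p -> 'I_p -> R -> R)
         (eps : 'I_p -> T' -> R) (sigma : 'I_p -> R),
    PLSEM Q D Y mu f eps sigma /\ same_law P X Q Y.

Definition elog {R : realType} (x : \bar R) : \bar R :=
  match x with
  | EFin r => if (0 < r)%R then EFin (ln r) else -oo%E
  | +oo%E => +oo%E
  | -oo%E => -oo%E
  end.

(* log sigma_j^D = (1/2) log (sigma_j^D)^2 *)
Definition log_proj_sd {R : realType} {d : measure_display} {T : measurableType d}
    (p : nat) (P : probability T R) (X : 'I_p -> T -> R) (D : rel 'I_p)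
    (j : 'I_p) : \bar R :=
  (elog (proj_resvar P X D j) * (2^-1)%:E)%E.

(* Main.v *)
(* Write q_D(x) for the sum over j of ((x_j - m_j(x)) / sigma_j)^2 / 2, where m_j
   is the regression function of X_j on its parents in D. A Gaussian PLSEM with
   DAG D has the density x |-> C_D exp (- q_D(x)), where C_D is the product of the
   peaks of the noise densities. Both D and D0 generate the law of X, so the
   densities agree everywhere, and q_D(x) <= q_D0(x) + ln C_D - ln C_D0. This
   pointwise inequality is then integrated against the law of the non-Gaussian
   X0, where E q_D0(X0) = p/2, and combined with ln t <= t - 1 applied to
   t = E (X0_j - m_j(X0))^2 / sigma_j^2. Conversely the projected residual
   variance under D0 is at least the noise variance, the noise being independent
   of the non-descendants.

   Densities on R^p are replaced by bounds on the probabilities of small boxes,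
   obtained by integrating out one sink of the DAG at a time. *)
Require Import Defs.
From HB Require Import structures.
From mathcomp Require Import all_boot all_order all_algebra.
From mathcomp Require Import all_classical all_reals all_analysis.
From mathcomp Require Import measurable_realfun normal_distribution.
From mathcomp Require Import ring lra.

Set Implicit Arguments.
Unset Strict Implicit.
Unset Printing Implicit Defensive.

Import Order.TTheory GRing.Theory Num.Theory.
Import numFieldNormedType.Exports.
Local Open Scope classical_set_scope.
Local Open Scope ring_scope.

(** * Integrals of nonnegative functions and independence *)

Lemma C2_continuous {R : realType} (f : R -> R) : C2 f -> continuous f.
Proof.
by move=> [df _] x; apply: differentiable_continuous; apply/derivable1_diffP.
Qed.

(* The integral of a nonnegative function is a supremum over the simple functions
   below it, so monotonicity does not require measurability. *)
Lemma ge0_le_integral_nomeas {R : realType} {d} {T : measurableType d}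
    (m : {measure set T -> \bar R}) (A : set T) (f1 f2 : T -> \bar R) :
  (forall x, A x -> (0 <= f1 x)%E) -> (forall x, A x -> (f1 x <= f2 x)%E) ->
  (\int[m]_(x in A) f1 x <= \int[m]_(x in A) f2 x)%E.
Proof.
move=> f10 f12.
have f12' x : ((f1 \_ A) x <= (f2 \_ A) x)%E.
  by rewrite !patchE; case: ifPn => //; rewrite inE => /f12.
have f10' x : (0 <= (f1 \_ A) x)%E.
  by rewrite !patchE; case: ifPn => //; rewrite inE => /f10.
rewrite !(integral_mkcond A) !ge0_integralTE//; last first.
  by move=> x; exact: le_trans (f10' x) (f12' x).
apply: ereal_sup_le => _ [h hf <-]; exists h => // x.
exact: le_trans (hf x) (f12' x).
Qed.

(** The factorization on rectangles identifies the joint law of [U] and [V] with the product of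
    their laws, and Tonelli applies there. In the result, [w'] plays the role of an independent copy
    of [w]. *)
Lemma ge0_integral_indep {R : realType} {d d1 d2 : measure_display}
    {T : measurableType d} {T1 : measurableType d1} {T2 : measurableType d2}
    (P : probability T R) (U : {mfun T >-> T1}) (V : {mfun T >-> T2})
    (F : T1 * T2 -> \bar R) :
  (forall A B, measurable A -> measurable B ->
     P (U @^-1` A `&` V @^-1` B) = P (U @^-1` A) * P (V @^-1` B))%E ->
  measurable_fun [set: T1 * T2] F -> (forall z, (0 <= F z)%E) ->
  (\int[P]_w F (U w, V w) = \int[P]_w \int[P]_w' F (U w, V w'))%E.
Proof.
move=> UV mF F0.
pose UV_mixin := isMeasurableFun.Build _ _ _ _ _
  (measurable_fun_pair (@measurable_funPT _ _ _ _ U) (@measurable_funPT _ _ _ _ V)).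
pose W : {mfun T >-> (T1 * T2)%type} := HB.pack (fun w => (U w, V w)) UV_mixin.
transitivity (\int[distribution P W]_z F z)%E; first by rewrite ge0_integral_distribution.
transitivity (\int[distribution P U \x distribution P V]_z F z)%E.
  apply: eq_measure_integral => A mA _; apply/esym.
  apply: product_measure_unique => //.
rewrite fubini_tonelli1//.
rewrite ge0_integral_distribution.
- apply: eq_integral => w _ /=; rewrite /fubini_F ge0_integral_distribution//.
  exact: measurable_fun_pair2.
- exact: measurable_fun_fubini_tonelli_F.
- by move=> x; apply: integral_ge0.
Qed.

(** * Sigma-algebras generated by subsets of the noises *)

Section Independence.
Context {R : realType} {d : measure_display} {T : measurableType d}.
Variables (P : probability T R) (p : nat) (eps : 'I_p -> T -> R).
Hypothesis meps : forall i, measurable_fun setT (eps i).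
Hypothesis indep : mutually_indep P eps.

(** A pi-system generating the sigma-algebra of the noises indexed by [S]. *)
Definition cylinders (S : {set 'I_p}) : set (set T) :=
  [set U | exists V : 'I_p -> set R, (forall i, measurable (V i)) /\
    U = \bigcap_(i in [set` S]) (eps i @^-1` V i)].

Lemma mutually_indep_in (A : {set 'I_p}) (V : 'I_p -> set R) :
  (forall i, measurable (V i)) ->
  P (\bigcap_(i in [set` A]) (eps i @^-1` V i)) =
  (\prod_(i in A) P (eps i @^-1` V i))%E.
Proof.
move=> mV; pose W i := if i \in A then V i else setT.
have mW i : measurable (W i) by rewrite /W; case: ifP.
transitivity (P (\bigcap_i (eps i @^-1` W i))).
  congr (P _); apply/seteqP; split => w /= h i.
    by move=> _; rewrite /W; case: ifP => // iA; exact: h.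
  by move=> /= iA; have := h i I; rewrite /W iA.
rewrite indep// [RHS]big_mkcond/=; apply: eq_bigr => i _; rewrite /W.
by case: ifP => // _; rewrite preimage_setT probability_setT.
Qed.

Lemma setI_closed_cylinders S : setI_closed (cylinders S).
Proof.
move=> _ _ [V [mV ->]] [W [mW ->]]; exists (fun i => V i `&` W i); split.
  by move=> i; exact: measurableI.
by rewrite -bigcapI; apply: eq_bigcapr => i _; rewrite preimage_setI.
Qed.

Lemma measurable_preimage_eps i (V : set R) :
  measurable V -> measurable (eps i @^-1` V).
Proof. by move=> mV; rewrite -[X in measurable X]setTI; exact: meps. Qed.

Lemma measurable_cylinders S : cylinders S `<=` measurable.
Proof.
move=> _ [V [mV ->]]; apply: fin_bigcap_measurable; first exact: finite_finset.
by move=> i _; exact: measurable_preimage_eps.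
Qed.

Lemma sigma_cylinders_measurable S :
  <<s cylinders S >> `<=` (measurable : set (set T)).
Proof.
apply: smallest_sub; first exact: sigma_algebra_measurable.
exact: measurable_cylinders.
Qed.

(** As functions of [E], both sides are finite measures; they agree on the pi-system of cylinders,
    hence on the sigma-algebra it generates. *)
Lemma indep_sigma_cylinders (S : {set 'I_p}) k (V : set R) E :
  k \notin S -> measurable V -> <<s cylinders S >> E ->
  P (E `&` eps k @^-1` V) = (P E * P (eps k @^-1` V))%E.
Proof.
move=> kS mV sE.
have mD := measurable_preimage_eps k mV.
have Dfin : P (eps k @^-1` V) \is a fin_num by exact: fin_num_measure.
have r0 : 0 <= fine (P (eps k @^-1` V)) by exact: fine_ge0.
have := @g_sigma_algebra_measure_unique _ R T (cylinders S)
  (@measurable_cylinders S) (fun=> setT) _ _ (mrestr P mD) (mscale (NngNum r0) P)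
  (@setI_closed_cylinders S).
rewrite /= /mrestr /mscale/= => -> //.
- by rewrite fineK// muleC.
- move=> _; exists (fun=> setT); split => //.
  by apply/seteqP; split.
- by rewrite bigcup_const//; exists 0%N.
- move=> _ [W [mW ->]]; rewrite fineK//.
  (* The intersection is itself a cylinder, over [S] enlarged by [k]; since [k] is not in [S], no
     condition of [W] is overwritten. *)
  pose W' i := if i == k then V else W i.
  have mW' i : measurable (W' i) by rewrite /W'; case: ifP.
  have W'k : W' k = V by rewrite /W' eqxx.
  have W'S i : i \in S -> W' i = W i.
    by rewrite /W'; case: eqP => // -> kS'; rewrite kS' in kS.
  have := mutually_indep_in (k |: S) mW'.
  rewrite big_setU1//= W'k.
  rewrite (eq_bigr (fun i => P (eps i @^-1` W i))); last by move=> i /W'S ->.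
  rewrite -mutually_indep_in// => <-; congr (P _).
  apply/seteqP; split => w /=.
    move=> [h hk] i /=; rewrite !inE => /orP[/eqP->|iS].
      by rewrite W'k.
    by rewrite W'S//; exact: h.
  move=> h; split.
    by move=> i /= iS; have := h i; rewrite /= W'S//; apply; rewrite inE iS orbT.
  by have := h k; rewrite /= W'k; apply; rewrite setU11.
- by move=> _; rewrite setTI -ge0_fin_numE.
Qed.

End Independence.

(** * Induction along a DAG *)

Section Dag.
Variables (p : nat) (D : rel 'I_p).
Hypothesis dagD : is_dag D.

(** Induction on the number of ancestors: a parent of [j] has fewer, as [j] is an ancestor of itself
    but, by acyclicity, not of its parent. *)
Lemma dag_ind (Pr : 'I_p -> Prop) :
  (forall j, (forall i, D i j -> Pr i) -> Pr j) -> forall j, Pr j.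
Proof.
move=> step j.
have [n] := ubnP #|[set i | connect D i j]%SET|; elim: n j => // n IH j jn.
apply: step => i Dij; apply: IH; rewrite -ltnS; apply: leq_trans jn; rewrite ltnS.
apply: proper_card; apply/properP; split.
  apply/fintype.subsetP => k; rewrite !inE => ki; apply: connect_trans ki _.
  exact: connect1.
by exists j; rewrite !inE ?connect0//; exact: dagD.
Qed.

Definition ancestral (S : {set 'I_p}) := forall i j, D i j -> j \in S -> i \in S.

(* A node of S with fewest descendants has no child in S. *)
Lemma ancestral_ind (Pr : {set 'I_p} -> Prop) :
  Pr (finset.set0) ->
  (forall (S : {set 'I_p}) k, ancestral S -> k \notin S ->
     (forall i, D i k -> i \in S) -> Pr S -> Pr (k |: S)%SET) ->
  forall S, ancestral S -> Pr S.
Proof.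
move=> P0 step S; have [n] := ubnP #|S|; elim: n S => // n IH S Sn ancS.
have [->//|[k0 k0S]] := set_0Vmem S.
case: (arg_minnP (fun k => #|[set i | connect D k i]%SET|) k0S) => k.
rewrite -[_ k]/(k \in S) => kS kmin.
have nochild j : D k j -> j \notin S.
  move=> Dkj; apply/negP => jS; have := kmin _ jS; rewrite leqNgt => /negP; apply.
  apply: proper_card; apply/properP; split.
    by apply/fintype.subsetP => i; rewrite !inE; apply: connect_trans; exact: connect1.
  by exists k; rewrite !inE ?connect0//; exact: dagD.
have pak i : D i k -> i \in (S :\ k)%SET.
  move=> Dik; rewrite !inE (ancS _ _ Dik kS) andbT; apply/eqP => ik.
  by have := dagD Dik; rewrite ik connect0.
have anc' : ancestral (S :\ k)%SET.
  move=> i j Dij; rewrite !inE => /andP[jk jS]; rewrite (ancS _ _ Dij jS) andbT.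
  by apply/eqP => ik; move: Dij; rewrite ik => /nochild; rewrite jS.
rewrite -(finset.setD1K kS); apply: step => //; first by rewrite !inE eqxx.
by apply: IH => //; move: Sn; rewrite (cardsD1 k S) kS.
Qed.

End Dag.

(** * Integral of a bounded density over an interval *)

Section DensityInterval.
Context {R : realType}.

Lemma integral_itv_bounds (g : R -> R) (a b lo up : R) :
  a <= b -> 0 <= lo -> measurable_fun setT g ->
  (forall e, a <= e <= b -> lo <= g e <= up) ->
  ((lo * (b - a))%:E <= \int[lebesgue_measure]_(x in `[a, b]) (g x)%:E
    <= (up * (b - a))%:E)%E.
Proof.
move=> ab lo0 mg gb.
have cE (c : R) : ((c * (b - a))%:E =
    \int[lebesgue_measure]_(x in `[a, b]) cst c%:E x)%E.
  rewrite [RHS]integral_cst//= lebesgue_measure_itv/= lte_fin EFinM.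
  by case: ltgtP ab => // ->; rewrite ?subrr ?mulr0 ?mule0.
have gb' x : `[a, b]%classic x -> lo <= g x <= up by rewrite /= in_itv/=; exact: gb.
have mgE : measurable_fun `[a, b] (EFin \o g).
  by apply/measurable_EFinP; exact: measurable_funS mg.
rewrite !cE; apply/andP; split; apply: ge0_le_integral => //.
- by move=> x /gb' /andP[h1 h2]; rewrite lee_fin; lra.
- by move=> x /gb' /andP[h1 h2]; rewrite lee_fin; lra.
- by move=> x /gb' /andP[h1 h2]; rewrite lee_fin; lra.
Qed.

End DensityInterval.

(** * Structural equations: nodes as functions of the noises *)

Section Sem.
Context {R : realType} {d : measure_display} {T : measurableType d}.
Variables (P : probability T R) (p : nat) (D : rel 'I_p).
Variables (X eps : 'I_p -> T -> R) (mu : 'I_p -> R) (f : 'I_p -> 'I_p -> R -> R).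
Hypothesis dagD : is_dag D.
Hypothesis meps : forall i, measurable_fun setT (eps i).
Hypothesis indep : mutually_indep P eps.
Hypothesis mf : forall i j, i \in pa D j -> measurable_fun setT (f j i).
Hypothesis mX : forall i, measurable_fun setT (X i).
Hypothesis XE :
  forall j w, X j w = mu j + \sum_(i in pa D j) f j i (X i w) + eps j w.

(** The argument is an arbitrary vector, so that the regression functions of one system can be
    evaluated along the variables of another. *)
Definition sem_mean j (y : 'I_p -> R) := mu j + \sum_(i in pa D j) f j i (y i).

(** The sample space with the coarser sigma-algebra of the noises in [S]: measurability there
    expresses being a function of these noises. *)
Local Notation cylT S := (g_sigma_algebraType (cylinders eps S)).

Lemma measurable_eps_cylinders (S : {set 'I_p}) i : i \in S ->
  measurable_fun setT (eps i : cylT S -> R).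
Proof.
move=> iS _ V mV; rewrite setTI; apply: sub_sigma_algebra.
exists (fun j => if j == i then V else setT); split.
  by move=> j; case: ifP.
apply/seteqP; split => w /=.
  by move=> h j _ /=; case: eqP => // ->.
by move/(_ i); rewrite /= eqxx; exact.
Qed.

(** Unfolding the equations along the DAG never leaves an ancestral set, so its nodes depend only on
    its own noises. *)
Lemma measurable_node_cylinders (S : {set 'I_p}) : ancestral D S ->
  forall j, j \in S -> measurable_fun setT (X j : cylT S -> R).
Proof.
move=> ancS; apply: (dag_ind dagD) => j IH jS.
rewrite (_ : X j = fun w : cylT S =>
  mu j + \sum_(i in pa D j) f j i (X i w) + eps j w); last first.
  by apply/funext => w; exact: XE.
apply: measurable_funD; last exact: measurable_eps_cylinders.
apply: measurable_funD => //.
under eq_fun do rewrite big_mkcond/=.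
apply: (@measurable_sum _ (cylT S)) => i.
have [iD|_] := boolP (i \in pa D j); last exact: measurable_cst.
apply: measurableT_comp; first exact: mf.
have Dij : D i j by move: iD; rewrite inE.
by apply: IH => //; exact: ancS Dij jS.
Qed.

(** The identity map into the coarser space is a random element independent of [eps k]; the noise of
    [k] can thus be integrated out with everything determined by [S] frozen. *)
Lemma integral_cylinders (S : {set 'I_p}) k (F : cylT S * R -> \bar R) :
  k \notin S -> measurable_fun setT F -> (forall z, (0 <= F z)%E) ->
  (\int[P]_w F (w, eps k w) = \int[P]_w \int[P]_w' F (w, eps k w'))%E.
Proof.
move=> kS mF F0.
have mU : measurable_fun setT (idfun : T -> cylT S).
  by move=> _ A mA; rewrite setTI; exact: (sigma_cylinders_measurable meps) mA.
pose U : {mfun T >-> cylT S} := mfun_Sub (mem_set mU).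
pose V : {mfun T >-> R} := mfun_Sub (mem_set (meps k)).
have := @ge0_integral_indep _ _ _ _ _ _ _ P U V F.
apply => //.
move=> A B mA mB; exact: (indep_sigma_cylinders meps indep kS mB mA).
Qed.

(** General summands [f'] cover both [sem_mean] and the difference of two additive predictors. *)
Lemma measurable_sem_mean (S : {set 'I_p}) k (f' : 'I_p -> R -> R) (c : R) :
  ancestral D S -> (forall i, D i k -> i \in S) ->
  (forall i, i \in pa D k -> measurable_fun setT (f' i)) ->
  measurable_fun setT (fun w : cylT S => c + \sum_(i in pa D k) f' i (X i w)).
Proof.
move=> ancS pak mf'; apply: measurable_funD => //.
under eq_fun do rewrite big_mkcond/=.
apply: (@measurable_sum _ (cylT S)) => i.
have [iD|_] := boolP (i \in pa D k); last exact: measurable_cst.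
apply: measurableT_comp; first exact: mf'.
by apply: measurable_node_cylinders => //; apply: pak; move: iD; rewrite inE.
Qed.

(** * Probabilities of boxes *)

Section Box.
Variables (g : 'I_p -> R -> R) (a b lo up : 'I_p -> R).
Hypothesis mg : forall j, measurable_fun setT (g j).
Hypothesis epsg : forall j (V : set R), measurable V ->
  P (eps j @^-1` V) = (\int[lebesgue_measure]_(x in V) (g j x)%:E)%E.
Hypothesis ab : forall j, a j <= b j.
Hypothesis lo0 : forall j, 0 <= lo j.
Hypothesis gbounds : forall j y, (forall i, a i <= y i <= b i) ->
  lo j <= g j (y j - sem_mean j y) <= up j.

(** The noise values that put node [k] into its interval when its parents take their values at
    [w]. *)
Let slice k (w : T) : set R :=
  `[a k - sem_mean k (X^~ w), b k - sem_mean k (X^~ w)].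

Lemma noise_slice_bounds k (w : T) (S : {set 'I_p}) :
  k \notin S -> (forall i, D i k -> i \in S) ->
  (forall i, i \in S -> a i <= X i w <= b i) ->
  ((lo k * (b k - a k))%:E <=
    P (eps k @^-1` slice k w)
    <= (up k * (b k - a k))%:E)%E.
Proof.
move=> kS pak Xw; rewrite /slice; set m := sem_mean _ _.
rewrite epsg// -(_ : b k - m - (a k - m) = b k - a k); last by ring.
apply: integral_itv_bounds => //; first by rewrite lerD2r.
move=> e; rewrite lerBlDr lerBrDr => eab.
(* A point of the box whose residual at [k] is exactly [e], so that [gbounds] applies. The value
   [a i] outside [S] only keeps the point in the box, since all parents of [k] lie in [S]. *)
pose y i := if i == k then e + m else if i \in S then X i w else a i.
have yk : y k = e + m by rewrite /y eqxx.
have my : sem_mean k y = m.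
  rewrite /m /sem_mean; congr (_ + _); apply: eq_bigr => i; rewrite inE => Dik.
  rewrite /y (pak _ Dik); case: eqP => // ik.
  by move: kS; rewrite -ik (pak _ Dik).
have yab i : a i <= y i <= b i.
  rewrite /y; case: eqP => [->//|_]; case: ifP => [/Xw//|_].
  by rewrite lexx ab.
by have := gbounds k yab; rewrite yk my addrK.
Qed.

Lemma box_step_integral (S : {set 'I_p}) k : ancestral D S -> k \notin S ->
  (forall i, D i k -> i \in S) ->
  let A := \bigcap_(i in [set` S]) (X i @^-1` `[a i, b i]) in
  P (A `&` X k @^-1` `[a k, b k]) =
  (\int[P]_(w in A) P (eps k @^-1` slice k w))%E.
Proof.
move=> ancS kS pak A.
have mA' : (cylinders eps S).-sigma.-measurable A.
  apply: fin_bigcap_measurable => // i /= iS.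
  rewrite -[X in measurable X]setTI.
  exact: (measurable_node_cylinders ancS iS).
have mA : measurable A by exact: (sigma_cylinders_measurable meps) mA'.
(* The event rewritten as a condition on the pair formed by the noises in [S] and the noise of
   [k]. *)
pose B : set (cylT S * R) :=
  [set z | A z.1 /\ a k <= sem_mean k (X^~ z.1) + z.2 <= b k].
have mB : measurable B.
  have mM : measurable_fun setT
      (fun z : cylT S * R => sem_mean k (X^~ z.1) + z.2).
    apply: measurable_funD => //=.
    apply: (@measurableT_comp _ _ _ _ _ _ (fun w : cylT S => sem_mean k (X^~ w)) _ fst) => //.
    by apply: measurable_sem_mean => // i ik; exact: mf.
  rewrite (_ : B = (fst @^-1` A) `&`
    ((fun z : cylT S * R => sem_mean k (X^~ z.1) + z.2) @^-1` `[a k, b k])).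
    apply: measurableI.
      by rewrite -[X in measurable X]setTI; exact: measurable_fst.
    by rewrite -[X in measurable X]setTI; exact: mM.
  by apply/seteqP; split => z /=; rewrite in_itv.
pose F : cylT S * R -> \bar R := EFin \o \1_B.
have mF : measurable_fun setT F.
  by apply/measurable_EFinP; exact: measurable_indic.
have F0 (z : cylT S * R) : (0 <= F z)%E by rewrite lee_fin.
have /= := integral_cylinders kS mF F0.
have mXk : measurable (A `&` X k @^-1` `[a k, b k]).
  by apply: measurableI => //; rewrite -[X in measurable X]setTI; exact: mX.
have FX w : F (w, eps k w) = (\1_(A `&` X k @^-1` `[a k, b k]) w)%:E.
  rewrite /F/= !indicE; congr (_%:R%:E); congr nat_of_bool.
  by apply/idP/idP; rewrite !inE /B/= in_itv/= XE.
under eq_integral do rewrite FX.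
rewrite integral_indic// setIT => ->.
rewrite [RHS]integral_mkcond/=; apply: eq_integral => w _; rewrite patchE.
have mslice : measurable (eps k @^-1` slice k w).
  by apply: measurable_preimage_eps => //; exact: measurable_itv.
case: ifPn => wA; last first.
  rewrite integral0_eq// => w' _; rewrite /F/= indicE memNset//= => -[Aw _].
  by rewrite notin_setE in wA.
rewrite -[RHS]/(P _) -[X in P X]setIT -integral_indic//.
apply: eq_integral => w' _; rewrite /F/= !indicE; congr (_%:R%:E); congr nat_of_bool.
rewrite inE in wA.
apply/idP/idP; rewrite !inE /B/= /slice/= in_itv/= lerBlDl lerBrDl //.
by case.
Qed.

(** Adding a node [k] whose parents are already in [S] multiplies the probability by a factor lying
    between the bounds for the slice of [k], uniformly on the smaller box. *)
Lemma box_prob (S : {set 'I_p}) : ancestral D S ->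
  ((\prod_(j in S) (lo j * (b j - a j)))%:E <=
    P (\bigcap_(i in [set` S]) (X i @^-1` `[a i, b i])) <=
   (\prod_(j in S) (up j * (b j - a j)))%:E)%E.
Proof.
move: S; apply: (ancestral_ind dagD).
  rewrite !big_set0 (_ : bigcap _ _ = setT) ?probability_setT ?lexx//.
  by apply/seteqP; split => w //= _ i /=; rewrite inE.
move=> S k ancS kS pak /andP[IHlo IHup].
pose A := \bigcap_(i in [set` S]) (X i @^-1` `[a i, b i]).
have -> : \bigcap_(i in [set` (k |: S)%SET]) (X i @^-1` `[a i, b i]) =
    A `&` X k @^-1` `[a k, b k].
  apply/seteqP; split => w /=.
    move=> h; split; last by apply: (h k); rewrite /= setU11.
    by move=> i /= iS; apply: (h i); rewrite /= inE iS orbT.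
  by move=> [h hk] i /=; rewrite !inE => /orP[/eqP->//|iS]; exact: h.
rewrite !big_setU1//= box_step_integral//.
have mA : measurable A.
  apply: fin_bigcap_measurable => // i _.
  by rewrite -[X in measurable X]setTI; exact: mX.
have cE (c : R) : (\int[P]_(w in A) (cst c%:E) w = c%:E * P A)%E by rewrite integral_cst.
have bnd w : A w -> ((lo k * (b k - a k))%:E <= P (eps k @^-1` slice k w)
    <= (up k * (b k - a k))%:E)%E.
  move=> Aw; apply: (noise_slice_bounds kS pak) => i iS.
  by have := Aw i iS; rewrite /= in_itv.
have dk : 0 <= b k - a k by rewrite subr_ge0.
apply/andP; split.
  rewrite EFinM; apply: le_trans (_ : (lo k * (b k - a k))%:E * P A <= _)%E.
    by apply: lee_wpmul2l => //; rewrite lee_fin mulr_ge0.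
  rewrite -cE; apply: ge0_le_integral_nomeas => w Aw /=.
    by rewrite lee_fin mulr_ge0.
  by have /andP[] := bnd w Aw.
rewrite EFinM; apply: (@le_trans _ _ ((up k * (b k - a k))%:E * P A)%E); last first.
  apply: lee_wpmul2l => //; rewrite lee_fin mulr_ge0//.
  (* Nonnegativity of [up k] is read off at the corner [a] of the box. *)
  have /andP[h1 h2] := gbounds k (fun i => andb_true_intro (conj (lexx (a i)) (ab i))).
  exact: le_trans (lo0 k) (le_trans h1 h2).
rewrite -cE; apply: ge0_le_integral_nomeas => w Aw //=.
by have /andP[] := bnd w Aw.
Qed.

End Box.

(** * Lower bound for the projected residual variance *)

Lemma noise_second_moment_shift (e : T -> R) (s t : R) :
  e \in Lfun P 2%:E -> ('V_P[e] = (s ^+ 2)%:E)%E ->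
  ((s ^+ 2)%:E <= \int[P]_w ((t + e w) ^+ 2)%:E)%E.
Proof.
move=> e2 Ve; have te2 : (cst t \+ e) \in Lfun P 2%:E.
  have ct : cst t \in Lfun P 2%:E by exact: Lfun_cst.
  by apply: (@rpredD _ (Lfun P 2%:E : addrClosed _) _ _ ct e2); rewrite lee_fin ler1n.
(* Variance is invariant under shifts and is the second moment minus a square. *)
rewrite -Ve -(varianceD_cst_l t e2) varianceE// unlock.
rewrite -[leRHS]sube0; by apply: leeB => //; exact: sqre_ge0.
Qed.

(** Every candidate residual is [eps j] plus a function [H] of the noises of non-descendants. With
    [H] frozen by independence, the remaining integral is a second moment of shifted noise. *)
Lemma proj_resvar_ge j (s : R) : eps j \in Lfun P 2%:E ->
  ('V_P[eps j] = (s ^+ 2)%:E)%E -> ((s ^+ 2)%:E <= proj_resvar P X D j)%E.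
Proof.
move=> e2 Ve; apply: le_ereal_inf_tmp => _ [c [g [gC ->]]]; rewrite unlock.
have mg i : i \in pa D j -> measurable_fun setT (g i).
  by move=> /gC/C2_continuous; exact: continuous_measurable_fun.
pose S : {set 'I_p} := [set i | ~~ connect D j i]%SET.
have jS : j \notin S by rewrite inE connect0.
have ancS : ancestral D S.
  move=> i k Dik; rewrite !inE; apply: contra => ji.
  by apply: connect_trans ji _; exact: connect1.
have pak i : D i j -> i \in S by move=> Dij; rewrite inE; exact: dagD.
pose H (w : cylT S) := mu j - c + \sum_(i in pa D j) (f j i (X i w) - g i (X i w)).
have mH : measurable_fun setT H.
  apply: (measurable_sem_mean (f' := fun i x => f j i x - g i x)) => // i iD.
  by apply: measurable_funB; [exact: mf|exact: mg].
pose F (z : cylT S * R) := ((H z.1 + z.2) ^+ 2)%:E.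
have mF : measurable_fun setT F.
  apply/measurable_EFinP; apply: measurable_funX; apply: measurable_funD => //=.
  exact: (@measurableT_comp _ _ _ _ _ _ H _ fst).
have F0 z : (0 <= F z)%E by rewrite lee_fin sqr_ge0.
have FE w : (((X j w - c - \sum_(i in pa D j) g i (X i w)) ^+ 2)%:E = F (w, eps j w))%E.
  by rewrite /F /H /= XE sumrB; congr (_ ^+ 2)%:E; ring.
under eq_integral do rewrite FE.
rewrite (integral_cylinders jS mF F0).
rewrite -[leLHS]mule1 -(@probability_setT _ _ _ P) -integral_cst//.
apply: ge0_le_integral_nomeas => w _; first by rewrite lee_fin sqr_ge0.
exact: (noise_second_moment_shift (H w) e2 Ve).
Qed.

End Sem.

(** * Log density of a Gaussian system *)

Section GaussianSem.
Context {R : realType}.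

Definition log_normal_pdf (s e : R) := ln (normal_peak s) - e ^+ 2 / (s ^+ 2 *+ 2).

Lemma normal_pdf_expR (s e : R) : s != 0 ->
  normal_pdf 0 s e = expR (log_normal_pdf s e).
Proof.
move=> s0; rewrite normal_pdfE// /log_normal_pdf expRD lnK ?posrE ?normal_peak_gt0//.
by rewrite /normal_fun subr0 mulNr.
Qed.

(** Common ground of a PLSEM and of the Gaussian system built on [D0], whose edge functions are
    centred under the law of [X0] rather than under its own. *)
Record gaussian_sem {d} {T : measurableType d} (P : probability T R) (p : nat)
    (D : rel 'I_p) (X : 'I_p -> T -> R) (mu : 'I_p -> R)
    (f : 'I_p -> 'I_p -> R -> R) (eps : 'I_p -> T -> R) (sigma : 'I_p -> R) : Prop := {
  gs_dag : is_dag D;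
  gs_meas : forall j, measurable_fun setT (X j);
  gs_noise_meas : forall j, measurable_fun setT (eps j);
  gs_cont : forall i j, i \in pa D j -> continuous (f j i);
  gs_indep : mutually_indep P eps;
  gs_sigma : forall j, 0 < sigma j;
  gs_gaussian : forall j, gaussian P (eps j) (sigma j);
  gs_eq : forall j w, X j w = mu j + \sum_(i in pa D j) f j i (X i w) + eps j w }.

Section LogDensity.
Context {d} {T : measurableType d} (P : probability T R) (p : nat)
  (D : rel 'I_p) (X : 'I_p -> T -> R) (mu : 'I_p -> R)
  (f : 'I_p -> 'I_p -> R -> R) (eps : 'I_p -> T -> R) (sigma : 'I_p -> R).
Hypothesis sem : gaussian_sem P D X mu f eps sigma.

Definition sem_log_pdf j (y : 'I_p -> R) :=
  log_normal_pdf (sigma j) (y j - sem_mean D mu f j y).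

Lemma sem_log_pdf_continuous (x : 'I_p -> R) (e : R) : 0 < e ->
  exists2 h, 0 < h & forall y, (forall i, `|x i - y i| <= h) ->
    forall j, `|sem_log_pdf j x - sem_log_pdf j y| <= e.
Proof.
move=> e0.
have cG U (F : set_system U) (FF : Filter F) (y : U -> 'I_p -> R) j :
    (forall i, y u i @[u --> F] --> x i) ->
    sem_log_pdf j (y u) @[u --> F] --> sem_log_pdf j x.
  move=> cy; rewrite /sem_log_pdf /log_normal_pdf /sem_mean.
  apply: cvgB; first exact: cvg_cst.
  apply: cvgM; last exact: cvg_cst.
  apply: (@continuous_cvg _ _ _ F FF _ (fun z : R => z ^+ 2)); first exact: exprn_continuous.
  apply: cvgB; first exact: cy.
  apply: cvgD; first exact: cvg_cst.
  apply: cvg_big => [|i iD]; first exact: add_continuous.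
  by apply: (@continuous_cvg _ _ _ F FF _ (f j i)); [exact: (gs_cont sem)|exact: cy].
(* Row vectors carry the sup norm, whose balls give one radius for all coordinates. *)
pose xv : 'rV[R]_p := \row_j x j.
have near_j j : nbhs xv
    [set y : 'rV[R]_p | `|sem_log_pdf j x - sem_log_pdf j (y 0)| <= e].
  have cj := @cG _ (nbhs xv) (nbhs_filter xv) (fun y : 'rV[R]_p => y 0) j.
  have /cj/cvgrPdist_le/(_ e e0) :
      forall i, (y : 'rV[R]_p) 0 i @[y --> nbhs xv] --> x i.
    move=> i; rewrite (_ : x i = xv 0 i); [exact: coord_continuous|by rewrite mxE].
  exact.
have := @filter_forall _ _ _ _ (nbhs_filter xv) near_j.
(* Halving turns the open ball into the closed condition on [h]. *)
move=> /nbhs_ballP[r /= r0 hr]; exists (r / 2); first by rewrite divr_gt0.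
move=> y yx j; have := hr (\row_i y i) _ j.
have E z : (\row_i z i : 'rV[R]_p) 0 = z by apply/funext => i; rewrite mxE.
rewrite !E; apply; split => // a b; rewrite !mxE.
by apply: le_lt_trans (yx b) _; lra.
Qed.

(** By continuity each noise density varies by a factor at most [expR e] either way on a small cube,
    and [box_prob] is applied to all nodes. *)
Lemma gaussian_sem_box (x : 'I_p -> R) (e : R) : 0 < e ->
  exists2 h0, 0 < h0 & forall h, 0 < h -> h <= h0 ->
   ((expR (\sum_j (sem_log_pdf j x - e)) * (h *+ 2) ^+ p)%:E <=
     P (\bigcap_j (X j @^-1` `[(x j - h)%R, (x j + h)%R])) <=
    (expR (\sum_j (sem_log_pdf j x + e)) * (h *+ 2) ^+ p)%:E)%E.
Proof.
move=> e0; have [h0 h00 hc] := sem_log_pdf_continuous x e0.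
exists h0 => // h hpos hh0.
have s0 j : sigma j != 0 by rewrite gt_eqF// (gs_sigma sem).
have := @box_prob R d T P p D X eps mu f (gs_dag sem) (gs_noise_meas sem)
  (gs_indep sem) _ (gs_meas sem) (gs_eq sem) (fun j => normal_pdf 0 (sigma j))
  (fun j => x j - h) (fun j => x j + h)
  (fun j => expR (sem_log_pdf j x - e)) (fun j => expR (sem_log_pdf j x + e))
  _ _ _ _ _ [set: 'I_p]%SET.
have -> : \bigcap_(i in [set` [set: 'I_p]%SET]) X i @^-1` `[x i - h, x i + h] =
    \bigcap_j (X j @^-1` `[(x j - h)%R, (x j + h)%R]).
  by apply/seteqP; split => w wX i _; apply: (wX i); rewrite /= ?inE.
have pE (F : 'I_p -> R) : \prod_(j in [set: 'I_p]%SET) (expR (F j) * (x j + h - (x j - h))) =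
    expR (\sum_j F j) * (h *+ 2) ^+ p.
  rewrite expR_sum -[X in _ ^+ X]card_ord -prodr_const -big_split/=.
  apply: eq_big => j; rewrite ?inE// => _; congr (_ * _); ring.
rewrite !pE; apply => //.
- by move=> i j iD; apply: continuous_measurable_fun; exact: (gs_cont sem).
- by move=> j; exact: measurable_normal_pdf.
- by move=> j V mV; rewrite (gs_gaussian sem).
- by move=> j; lra.
- move=> j y yb; rewrite normal_pdf_expR// !ler_expR.
  have := hc y _ j; rewrite -/(sem_log_pdf j y) ler_norml.
  have yb' i : `|x i - y i| <= h0.
    by have := yb i; move=> /andP[? ?]; rewrite ler_norml; apply/andP; split; lra.
  by move=> /(_ yb') /andP[? ?]; apply/andP; split; lra.
- by move=> i j _ _; rewrite inE.
Qed.

End LogDensity.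

(** A small cube around [x] has the same probability under both laws; comparing the lower bound from
    one system with the upper bound from the other, the volume cancels. *)
Lemma gaussian_sem_log_pdf_le {d d'} {T : measurableType d} {T' : measurableType d'}
    (P : probability T R) (Q : probability T' R) (p : nat)
    (D : rel 'I_p) (X : 'I_p -> T -> R) (mu : 'I_p -> R)
    (f : 'I_p -> 'I_p -> R -> R) (eps : 'I_p -> T -> R) (sigma : 'I_p -> R)
    (D' : rel 'I_p) (Y : 'I_p -> T' -> R) (mu' : 'I_p -> R)
    (f' : 'I_p -> 'I_p -> R -> R) (eps' : 'I_p -> T' -> R) (sigma' : 'I_p -> R) :
  gaussian_sem P D X mu f eps sigma -> gaussian_sem Q D' Y mu' f' eps' sigma' ->
  same_law P X Q Y -> forall x : 'I_p -> R,
  \sum_j sem_log_pdf D mu f sigma j x <= \sum_j sem_log_pdf D' mu' f' sigma' j x.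
Proof.
move=> semX semY XY x; apply/ler_addgt0Pr => e e0.
(* The two bounds lose [e'] per coordinate each, in total [2 p e']; the added 1 keeps the
   denominator positive when [p] is 0. *)
pose e' := e / (p%:R *+ 2 + 1).
have p0 : 0 <= p%:R :> R by [].
have e'0 : 0 < e' by apply: divr_gt0 => //; lra.
have [h1 h10 H1] := gaussian_sem_box semX x e'0.
have [h2 h20 H2] := gaussian_sem_box semY x e'0.
pose h := Num.min h1 h2.
have h0 : 0 < h by rewrite lt_min h10.
have /andP[+ _] : _ := H1 h h0 ltac:(by rewrite ge_min lexx).
have /andP[_ +] : _ := H2 h h0 ltac:(by rewrite ge_min lexx orbT).
rewrite -XY; last by move=> i; exact: measurable_itv.
move=> /[swap] /le_trans /[apply]; rewrite lee_fin ler_pM2r; last first.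
  by rewrite exprn_gt0// mulrn_wgt0.
rewrite ler_expR.
have sE (F : 'I_p -> R) c : \sum_j (F j + c) = \sum_j F j + c * p%:R.
  by rewrite big_split/= sumr_const card_ord mulr_natr.
rewrite !sE.
have : e' * (p%:R *+ 2) <= e.
  rewrite /e' mulrAC ler_pdivrMr; last lra.
  by rewrite ler_pM2l//; lra.
rewrite mulrnAr mulNr.
set u := _ * _; set v := \sum_j _; set w := \sum_j _.
lra.
Qed.

End GaussianSem.

(** * Logarithms of peaks and variances *)

Section Logs.
Context {R : realType}.

Lemma ln_normal_peak (s : R) : 0 < s ->
  ln (normal_peak s) = ln (normal_peak 1) - ln s.
Proof.
move=> s0; rewrite -ln_div ?posrE ?normal_peak_gt0//; congr (ln _).
rewrite /normal_peak expr1n mul1r -mulrnAr sqrtrM ?sqr_ge0// sqrtr_sqr gtr0_norm//.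
by rewrite invfM mulrC.
Qed.

(** This is [ln t <= t - 1] at [t = tau / s ^ 2], halved; where [tau] is not positive, [elog] is
    [-oo]. *)
Lemma elog_le (tau : \bar R) (r s : R) : 0 < s -> (tau <= r%:E)%E ->
  (elog tau * (2^-1)%:E <= (r / (s ^+ 2 *+ 2) - 2^-1 + ln s)%:E)%E.
Proof.
move=> s0; have Ny : (-oo * (2^-1)%:E = -oo :> \bar R)%E by rewrite gt0_mulNye// lte_fin; lra.
case: tau => [x|//|_] /=; last by rewrite Ny leNye.
rewrite lee_fin => xr; case: ifPn => x0; last by rewrite Ny leNye.
have s20 : 0 < s ^+ 2 by rewrite exprn_gt0.
have lnx : ln x = ln (1 + (x / s ^+ 2 - 1)) + ln s *+ 2.
  rewrite (_ : 1 + _ = x / s ^+ 2); last by ring.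
  by rewrite ln_div ?posrE// lnXn// subrK.
have : ln (1 + (x / s ^+ 2 - 1)) <= x / s ^+ 2 - 1.
  by apply: le_ln1Dx; have := divr_gt0 x0 s20; lra.
have : x / s ^+ 2 <= r / s ^+ 2 by rewrite ler_pM2r ?invr_gt0.
have -> : r / (s ^+ 2 *+ 2) = r / s ^+ 2 / 2.
  by rewrite -mulr_natr invfM mulrA.
by rewrite -EFinM lee_fin lnx; lra.
Qed.

Lemma elog_ge (tau : \bar R) (s : R) : 0 < s -> ((s ^+ 2)%:E <= tau)%E ->
  ((ln s)%:E <= elog tau * (2^-1)%:E)%E.
Proof.
move=> s0; have s20 : 0 < s ^+ 2 by rewrite exprn_gt0.
case: tau => [x||] /=; last 2 first.
- by rewrite gt0_mulye ?lte_fin ?leey//; lra.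
- by [].
rewrite lee_fin => sx; rewrite (lt_le_trans s20 sx) -EFinM lee_fin.
have : ln (s ^+ 2) <= ln x by rewrite ler_ln ?posrE//; exact: lt_le_trans sx.
by rewrite lnXn//; lra.
Qed.

End Logs.

Lemma PLSEM_gaussian_sem {R : realType} {d} {T : measurableType d}
    (Q : probability T R) p (D : rel 'I_p) (Y : 'I_p -> T -> R) mu f eps sigma :
  PLSEM Q D Y mu f eps sigma -> gaussian_sem Q D Y mu f eps sigma.
Proof.
move=> [[dag [mY [meps [C2f [ind [noise YE]]]]]] ga]; split => //.
- by move=> i j /C2f[/C2_continuous].
- by move=> j; have [_ [_ []]] := noise j.
Qed.

Lemma noise_second_moment {R : realType} {d} {T : measurableType d}
    (P : probability T R) (e : T -> R) (s : R) :
  ('E_P[e] = 0)%E -> e \in Lfun P 2%:E -> ('V_P[e] = (s ^+ 2)%:E)%E ->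
  (\int[P]_w (e w ^+ 2)%:E = (s ^+ 2)%:E)%E.
Proof.
by move=> e0 e2 <-; rewrite varianceE// e0 expe2 mule0 sube0 unlock.
Qed.

(** * Comparison of the two DAGs under the law of [X0] *)

Section Comparison.
Context {R : realType} {d} {T : measurableType d} (P : probability T R) (p : nat)
  (D0 : rel 'I_p) (X0 : 'I_p -> T -> R) (mu0 : 'I_p -> R)
  (f0 : 'I_p -> 'I_p -> R -> R) (eps0 : 'I_p -> T -> R) (sigma0 : 'I_p -> R).
Hypothesis gen0 : gen_PLSEM P D0 X0 mu0 f0 eps0 sigma0.
Context (D : rel 'I_p) (mu : 'I_p -> R) (f : 'I_p -> 'I_p -> R -> R)
  (sigma : 'I_p -> R).
Hypothesis C2f : forall j i, i \in pa D j -> C2 (f j i).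
Hypothesis sigma_gt0 : forall j, 0 < sigma j.
Hypothesis log_pdf_le : forall x : 'I_p -> R,
  \sum_j sem_log_pdf D0 mu0 f0 sigma0 j x <= \sum_j sem_log_pdf D mu f sigma j x.

(** The residuals of [X0] under the regression functions of [D]. [K] is [ln C_D - ln C_D0], and the
    [rho j] sum to the expectation of [q_D(X0)], taken in the extended reals because finiteness is
    only derived later. *)
Let res j w := X0 j w - sem_mean D mu f j (X0^~ w).
Let K := \sum_j ln (normal_peak (sigma j)) - \sum_j ln (normal_peak (sigma0 j)).
Let rho j : \bar R := (\int[P]_w (res j w ^+ 2 / (sigma j ^+ 2 *+ 2))%:E)%E.

Lemma measurable_res j : measurable_fun setT (res j).
Proof.
have [_ [mX _]] := gen0.
rewrite /res /sem_mean; apply: measurable_funB => //; apply: measurable_funD => //.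
under eq_fun do rewrite big_mkcond/=.
apply: measurable_sum => i.
have [iD|_] := boolP (i \in pa D j); last exact: measurable_cst.
apply: measurableT_comp => //; apply: continuous_measurable_fun.
exact: C2_continuous (C2f iD).
Qed.

Lemma sum_rho_le : (\sum_j rho j <= (p%:R / 2 + K)%:E)%E.
Proof.
have [_ [mX [me [_ [_ [noise XE]]]]]] := gen0.
have s0 j : 0 < sigma0 j by have [_ [_ []]] := noise j.
(* The terms of [q_D0(X0)]: the residuals under [D0] are the noises, so each has mean 1/2. *)
pose V j w := eps0 j w ^+ 2 / (sigma0 j ^+ 2 *+ 2).
have den_ge0 (s : 'I_p -> R) j : 0 <= (s j ^+ 2 *+ 2)^-1.
  by rewrite invr_ge0 mulrn_wge0// sqr_ge0.
have V0 j w : 0 <= V j w by rewrite mulr_ge0// sqr_ge0.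
have mV j : measurable_fun setT (V j).
  by apply: measurable_funM => //; apply: measurable_funX; exact: me.
have VE j : (\int[P]_w (V j w)%:E = (2^-1)%:E)%E.
  under eq_integral do rewrite /V mulrC EFinM.
  rewrite ge0_integralZl//; last 3 first.
  - by apply/measurable_EFinP; apply: measurable_funX; exact: me.
  - by move=> w _; rewrite lee_fin sqr_ge0.
  - by rewrite lee_fin.
  have [e0 [e2 [_ [ve _]]]] := noise j.
  rewrite (noise_second_moment e0 e2 ve) -EFinM; congr EFin.
  by rewrite -mulr_natr; field; rewrite gt_eqF.
have sumVE : (\int[P]_w (\sum_j V j w)%:E = (p%:R / 2)%:E)%E.
  under eq_integral do rewrite -sumEFin.
  rewrite ge0_integral_sum//; last 2 first.
  - by move=> j; apply/measurable_EFinP.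
  - by move=> j w _; rewrite lee_fin.
  under eq_bigr do rewrite VE.
  by rewrite sumEFin sumr_const card_ord -[_ *+ p]mulr_natl.
have intV : P.-integrable setT (EFin \o (fun w => \sum_j V j w)).
  apply/integrableP; split.
    by apply/measurable_EFinP; exact: measurable_sum.
  under eq_integral do rewrite /= ger0_norm ?sumr_ge0//.
  by rewrite sumVE ltry.
(* [K] may be negative, so additivity rests on integrability. *)
have -> : ((p%:R / 2 + K)%:E = \int[P]_w ((\sum_j V j w)%:E + K%:E))%E.
  rewrite integralD//; last exact: finite_measure_integrable_cst.
  rewrite sumVE integral_cst//.
  by rewrite [X in (_ * X)%E](_ : _ = 1%E) ?mule1//; exact: probability_setT.
rewrite /rho -ge0_integral_sum//; last 2 first.
- move=> j; apply/measurable_EFinP; apply: measurable_funM => //.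
  by apply: measurable_funX; exact: measurable_res.
- by move=> j w _; rewrite lee_fin mulr_ge0// sqr_ge0.
apply: ge0_le_integral_nomeas => w _.
  by apply: sume_ge0 => j _; rewrite lee_fin mulr_ge0// sqr_ge0.
rewrite sumEFin -EFinD lee_fin.
have := log_pdf_le (X0^~ w); rewrite /sem_log_pdf /log_normal_pdf !sumrB /K.
have -> : \sum_j (X0 j w - sem_mean D0 mu0 f0 j (X0^~ w)) ^+ 2 /
    (sigma0 j ^+ 2 *+ 2) = \sum_j V j w.
  apply: eq_bigr => j _; rewrite /V; congr (_ ^+ 2 / _).
  by rewrite XE /sem_mean; ring.
rewrite -/(res _ w); lra.
Qed.

Lemma sum_log_proj_sd_le :
  (\sum_(j < p) log_proj_sd P X0 D j <= \sum_(j < p) log_proj_sd P X0 D0 j)%E.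
Proof.
have [dag [mX [me [fC [ind [noise XE]]]]]] := gen0.
have s0 j : 0 < sigma0 j by have [_ [_ []]] := noise j.
(* The noise variances of [D0] separate the two sides; [proj_resvar_ge] settles the [D0] side. *)
apply: (@le_trans _ _ (\sum_(j < p) (ln (sigma0 j))%:E)%E); last first.
  apply: lee_sum => j _; rewrite /log_proj_sd; apply: elog_ge => //.
  have [_ [e2 [_ [ve _]]]] := noise j.
  apply: (@proj_resvar_ge _ _ _ P p D0 X0 eps0 mu0 f0) => // i k iD.
  by apply: continuous_measurable_fun; apply: C2_continuous; case: (fC k i iD).
have rho0 j : (0 <= rho j)%E.
  apply: integral_ge0 => w _; rewrite lee_fin mulr_ge0 ?sqr_ge0// invr_ge0.
  by rewrite mulrn_wge0// sqr_ge0.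
have rho_fin j : rho j \is a fin_num.
  rewrite ge0_fin_numE//; apply: le_lt_trans (ltry (p%:R / 2 + K)).
  by apply: le_trans sum_rho_le; rewrite (bigD1 j)//= leeDl// sume_ge0.
(* The mean squared residual, with the normalization in [rho j] undone. It bounds the infimum since
   [mu j] and [f j] are admissible there. *)
pose r j := fine (rho j) * (sigma j ^+ 2 *+ 2).
have s20 j : 0 < sigma j ^+ 2 *+ 2 by rewrite mulrn_wgt0// exprn_gt0.
have tau_le j : (proj_resvar P X0 D j <= (r j)%:E)%E.
  apply: ereal_inf_lbound; exists (mu j), (f j); split; first by move=> i; exact: C2f.
  rewrite unlock /r EFinM fineK// muleC /rho -ge0_integralZl//; last 3 first.
  - apply/measurable_EFinP; apply: measurable_funM => //.
    by apply: measurable_funX; exact: measurable_res.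
  - by move=> w _; rewrite lee_fin mulr_ge0 ?sqr_ge0// invr_ge0 ltW.
  - by rewrite lee_fin ltW.
  apply: eq_integral => w _; rewrite -EFinM mulrC divfK ?gt_eqF//.
  by rewrite /res /sem_mean; congr (_ ^+ 2)%:E; ring.
apply: (@le_trans _ _ (\sum_(j < p) (fine (rho j) - 2^-1 + ln (sigma j))%:E)%E).
  apply: lee_sum => j _; have := elog_le (sigma_gt0 j) (tau_le j).
  by rewrite /r mulfK// gt_eqF.
rewrite !sumEFin lee_fin big_split/= sumrB sumr_const card_ord -[_ *+ p]mulr_natl.
have : \sum_j fine (rho j) <= p%:R / 2 + K.
  by rewrite -lee_fin -sumEFin; under eq_bigr do rewrite fineK//; exact: sum_rho_le.
rewrite /K.
have pk (s : 'I_p -> R) : (forall j, 0 < s j) -> \sum_j ln (normal_peak (s j)) =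
    p%:R * ln (normal_peak 1) - \sum_j ln (s j).
  move=> spos; under eq_bigr do rewrite ln_normal_peak//.
  by rewrite sumrB sumr_const card_ord mulr_natl.
(* The constants [p / 2] and the standard peaks cancel, and the [ln (sigma j)] coming from [elog_le]
   cancel those in [K], leaving the sum of [ln (sigma0 j)]. *)
rewrite !pk//; lra.
Qed.

End Comparison.

Theorem mainTheorem8 (R : realType) (p : nat)
    (d : measure_display) (T : measurableType d) (P : probability T R)
    (D0 : rel 'I_p) (X0 : 'I_p -> T -> R) (mu0 : 'I_p -> R)
    (f0 : 'I_p -> 'I_p -> R -> R) (eps0 : 'I_p -> T -> R) (sigma0 : 'I_p -> R) :
  gen_PLSEM P D0 X0 mu0 f0 eps0 sigma0 ->
  forall (d' : measure_display) (T' : measurableType d') (Q : probability T' R)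
         (X eps : 'I_p -> T' -> R),
    (forall j, measurable_fun setT (X j)) ->
    (forall j, measurable_fun setT (eps j)) ->
    mutually_indep Q eps ->
    (forall j, gaussian Q (eps j) (sigma0 j)) ->
    (forall j w, X j w = mu0 j + \sum_(i in pa D0 j) f0 j i (X i w) + eps j w) ->
  forall D : rel 'I_p, in_scrD Q X D ->
    (\sum_(j < p) log_proj_sd P X0 D j <= \sum_(j < p) log_proj_sd P X0 D0 j)%E.
Proof.
move=> gen0 d' T' Q X eps mX meps ind ga XE D.
move=> [_ [d2 [T2 [Q2 [Y [mu [f [eps2 [sigma [semY XY]]]]]]]]]].
have gsY := PLSEM_gaussian_sem semY.
have [dag [_ [_ [fC [_ [noise _]]]]]] := gen0.
have gsX : gaussian_sem Q D0 X mu0 f0 eps sigma0.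
  split => //.
  - by move=> i j /fC[/C2_continuous].
  - by move=> j; have [_ [_ []]] := noise j.
have [[_ [_ [_ [C2f _]]]] _] := semY.
(* The log density inequality holds at every point, hence along [X0], whose law need not be
   Gaussian. *)
apply: (sum_log_proj_sd_le gen0 (fun j i iD => (C2f j i iD).1) (gs_sigma gsY)).
exact: gaussian_sem_log_pdf_le gsX gsY XY.
Qed.
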